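(* Let $\rho\in\mathbb R_+^C$ and $\varepsilon\in\mathbb R_+$ with $\sum_{c=1}^C\widehat p_c\rho_c\le\varepsilon$, and let $w\in\mathcal W$. For each $c$, let $\gamma_c^\star>0$ be a solution of \[\Psi\big(\widehat\theta_c-\gamma^{-1}\lambda(w,\widehat x_c)\big)+\gamma^{-1}\big\langle\nabla\Psi\big(\widehat\theta_c-\gamma^{-1}\lambda(w,\widehat x_c)\big),\lambda(w,\widehat x_c)\big\rangle=\Psi(\widehat\theta_c)-\rho_c,\] set $\theta_c^\star=\widehat\theta_c-\lambda(w,\widehat x_c)/\gamma_c^\star$, let $\mathbb Q^\star_{Y|\widehat x_c}$ be the distribution with density $f(\cdot|\theta_c^\star)$, and $t_c^\star=\Psi(\lambda(w,\widehat x_c))-\langle\nabla\Psi(\theta_c^\star),\lambda(w,\widehat x_c)\rangle$. Let $\alpha^\star\in\mathbb R$, $\beta^\star>0$ solve \[\sum_{c=1}^C\widehat p_c\exp\big(\beta^{-1}(t_c^\star-\alpha)-\rho_c-1\big)-1=0,\qquad\sum_{c=1}^C\widehat p_c(t_c^\star-\alpha)\exp\big(\beta^{-1}(t_c^\star-\alpha)-\rho_c-1\big)-(\varepsilon+1)\beta=0.\] Then the worst-case distribution $\arg\max_{\mathbb Q\in\mathbb B(\widehat{\mathbb P})}\mathbb E_{\mathbb Q}[\ell_\lambda(X,Y,w)]$ is \[\mathbb Q^\star=\sum_{c=1}^C\widehat p_c\exp\big((\beta^\star)^{-1}(t_c^\star-\alpha^\star)-\rho_c-1\big)\,\delta_{\widehat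 x_c}\otimes\mathbb Q^\star_{Y|\widehat x_c},\] i.e. $\mathbb Q^\star\in\mathbb B(\widehat{\mathbb P})$ and $\mathbb E_{\mathbb Q^\star}[\ell_\lambda(X,Y,w)]=\max_{\mathbb Q\in\mathbb B(\widehat{\mathbb P})}\mathbb E_{\mathbb Q}[\ell_\lambda(X,Y,w)]$.
   Context: Exponential family: $\nu$ a measure on $\mathcal Y\subseteq\mathbb R^m$, $h\ge0$, $T:\mathcal Y\to\mathbb R^p$; $f(y|\theta)=h(y)\exp(\langle\theta,T(y)\rangle-\Psi(\theta))$ density w.r.t. $\nu$; $\Theta=\{\theta\in\mathbb R^p:\int he^{\langle\theta,T\rangle}d\nu<\infty\}$, $\Psi(\theta)=\log\int he^{\langle\theta,T\rangle}d\nu$; regular family ($\Theta$ open, $T_i$ affinely independent). $\mathcal X\subseteq\mathbb R^n$, $\mathcal W$ finite-dimensional, $\lambda:\mathcal W\times\mathcal X\to\Theta$ jointly continuous; $\ell_\lambda(x,y,w)=\Psi(\lambda(w,x))-\langle T(y),\lambda(w,x)\rangle$. Distinct $\widehat x_1,\dots,\widehat x_C\in\mathcal X$. Nominal distribution $\widehat{\mathbb P}$: marginal $\sum_c\widehat p_c\delta_{\widehat x_c}$ ($\widehat p\in\mathbb R_+^C$ summing to 1), conditional at $\widehat x_c$ with density $f(\cdot|\widehat\theta_c)$, $\widehat\theta_c\in\Theta$. KL divergence $\mathrm{KL}(\mathbb P_1\|\mathbb P_2)=\mathbb E_{\mathbb P_1}[\log d\mathbb P_1/d\mathbb P_2]$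 if $\mathbb P_1\ll\mathbb P_2$, else $+\infty$. Ambiguity set $\mathbb B(\widehat{\mathbb P})$: all probability measures $\mathbb Q$ on $\mathcal X\times\mathcal Y$ for which there exist a probability measure $\mathbb Q_X$ on $\mathcal X$ and $\theta_c\in\Theta$ such that, with $\mathbb Q_{Y|\widehat x_c}$ having density $f(\cdot|\theta_c)$: $\mathbb Q(\{\widehat x_c\}\times A)=\mathbb Q_X(\{\widehat x_c\})\mathbb Q_{Y|\widehat x_c}(A)$ for all $c$ and measurable $A$; $\mathrm{KL}(\mathbb Q_{Y|\widehat x_c}\|\widehat{\mathbb P}_{Y|\widehat x_c})\le\rho_c$; $\mathrm{KL}(\mathbb Q_X\|\widehat{\mathbb P}_X)+\sum_c\rho_c\mathbb Q_X(\{\widehat x_c\})\le\varepsilon$. *)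

(* Defs.v *)
From mathcomp Require Import all_boot all_order all_algebra.
From mathcomp Require Import all_classical all_reals all_analysis.
Import Order.TTheory GRing.Theory Num.Theory numFieldTopology.Exports numFieldNormedType.Exports.
Local Open Scope ring_scope.
Local Open Scope classical_set_scope.

(* Conventions:  R^n is represented by [n.-tuple R] when it carries a
   measurable structure (product Borel sigma-algebra), and by ['rV[R]_p]
   (row vectors, a normed space) for parameters. *)

Definition dotp {R : realType} {p : nat} (u v : 'rV[R]_p) : R :=
  \sum_(i < p) u ord0 i * v ord0 i.

Definition grad {R : realType} {p : nat} (f : 'rV[R]_p -> R) (x : 'rV[R]_p)
  : 'rV[R]_p := \row_(i < p) ('D_(delta_mx ord0 i) f x).

(* row vector -> tuple (to transport the topology of R^n to tuples) *)
Definition tup_of_row {R : realType} {n : nat} (r : 'rV[R]_n) : n.-tuple R :=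
  [tuple r ord0 i | i < n].

Definition Zint {R : realType} {m p : nat}
  (nu : {measure set (m.-tuple R) -> \bar R}) (Y : set (m.-tuple R))
  (h : m.-tuple R -> R) (T : m.-tuple R -> 'rV[R]_p) (th : 'rV[R]_p) : \bar R :=
  (\int[nu]_(y in Y) (h y * expR (dotp th (T y)))%:E)%E.

Definition Theta {R : realType} {m p : nat}
  (nu : {measure set (m.-tuple R) -> \bar R}) (Y : set (m.-tuple R))
  (h : m.-tuple R -> R) (T : m.-tuple R -> 'rV[R]_p) : set 'rV[R]_p :=
  [set th | (Zint nu Y h T th < +oo)%E].

(* log-partition function Psi (meaningful on Theta) *)
Definition Psi {R : realType} {m p : nat}
  (nu : {measure set (m.-tuple R) -> \bar R}) (Y : set (m.-tuple R))
  (h : m.-tuple R -> R) (T : m.-tuple R -> 'rV[R]_p) (th : 'rV[R]_p) : R :=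
  ln (fine (Zint nu Y h T th)).

Definition fdens {R : realType} {m p : nat}
  (nu : {measure set (m.-tuple R) -> \bar R}) (Y : set (m.-tuple R))
  (h : m.-tuple R -> R) (T : m.-tuple R -> 'rV[R]_p) (th : 'rV[R]_p)
  (y : m.-tuple R) : R :=
  h y * expR (dotp th (T y) - Psi nu Y h T th).

Definition has_density {R : realType} {m : nat}
  (nu : {measure set (m.-tuple R) -> \bar R}) (Y : set (m.-tuple R))
  (g : m.-tuple R -> R) (P : probability (m.-tuple R) R) : Prop :=
  forall A, measurable A -> P A = (\int[nu]_(y in A `&` Y) (g y)%:E)%E.

Section KLsec.
Local Open Scope charge_scope.
Definition KL {d} {T : measurableType d} {R : realType}
  (P1 P2 : probability T R) : \bar R :=
  if `[< P1 `<< P2 >] then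
    (\int[P1]_x (ln (fine ('d (charge_of_finite_measure P1) '/d P2 x)))%:E)%E
  else +oo%E.
End KLsec.

Definition loss {R : realType} {k n m p : nat}
  (nu : {measure set (m.-tuple R) -> \bar R}) (Y : set (m.-tuple R))
  (h : m.-tuple R -> R) (T : m.-tuple R -> 'rV[R]_p)
  (lam : 'rV[R]_k -> n.-tuple R -> 'rV[R]_p)
  (x : n.-tuple R) (y : m.-tuple R) (w : 'rV[R]_k) : R :=
  Psi nu Y h T (lam w x) - dotp (T y) (lam w x).

(* the ambiguity set B(P^), given the nominal marginal PX and the nominal
   conditionals PY c = P^_{Y | x^_c} *)
Definition ambiguity_set {R : realType} {n m p C : nat}
  (nu : {measure set (m.-tuple R) -> \bar R}) (Y : set (m.-tuple R))
  (h : m.-tuple R -> R) (T : m.-tuple R -> 'rV[R]_p)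
  (xh : 'I_C -> n.-tuple R) (PX : probability (n.-tuple R) R)
  (PY : 'I_C -> probability (m.-tuple R) R)
  (rho : 'I_C -> R) (eps : R)
  : set (probability (n.-tuple R * m.-tuple R)%type R) :=
  [set Q | exists (QX : probability (n.-tuple R) R) (th : 'I_C -> 'rV[R]_p)
             (QY : 'I_C -> probability (m.-tuple R) R),
     [/\ (forall c, Theta nu Y h T (th c)),
         (forall c, has_density nu Y (fdens nu Y h T (th c)) (QY c)),
         (forall c A, measurable A ->
            Q ([set xh c] `*` A) = (QX [set xh c] * QY c A)%E),
         (forall c, (KL (QY c) (PY c) <= (rho c)%:E)%E) &
         (KL QX PX + \sum_(c < C) ((rho c)%:E * QX [set xh c]) <= eps%:E)%E]].

(* Main.v *)
(* Both maximizations are solved by a Gibbs inequality. For the conditionals, the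
   mean of [T] under the density of parameter [th] is the gradient of [Psi] at
   [th], so KL divergences and expected losses are affine in that gradient; since
   the divergence from a competitor to the tilted density of parameter
   [thh c - (gam c)^-1 *: lam w (xh c)] is nonnegative, a competitor within KL
   radius [rho c] of the nominal conditional has expected loss at most t_c. For
   the marginals, put phi_c = (t_c - alpha) / beta - rho_c - 1: by the first
   equation for (alpha, beta) the weights p_c exp(phi_c) sum to 1, hence
   KL(q || p) >= sum_c q_c phi_c, which rearranges to
   sum_c q_c t_c <= alpha + beta (eps + 1), with equality at the tilted weights by
   the second equation. *)
Require Import Defs.
From HB Require Import structures.
From mathcomp Require Import all_boot all_order all_algebra.
From mathcomp Require Import all_classical all_reals all_analysis.
From mathcomp Require Import measurable_realfun.
From mathcomp Require Import ring lra.
Import Order.TTheory GRing.Theory Num.Theory numFieldTopology.Exports numFieldNormedType.Exports.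
Local Open Scope ring_scope.
Local Open Scope classical_set_scope.
Set Implicit Arguments.
Unset Strict Implicit.
Unset Printing Implicit Defensive.

Import HBNNSimple.

(* [f] is arbitrary: the loss is only measurable on the support of the
   distributions of interest, since [lam] and [T] are unconstrained outside
   [Xsp] and [Ysp]. *)
Lemma integral_conull d (T : measurableType d) (R : realType)
    (mu : {measure set T -> \bar R}) (D : set T) (f : T -> \bar R) :
  measurable D -> mu (~` D) = 0%E ->
  (\int[mu]_x f x = \int[mu]_(x in D) f x)%E.
Proof.
move=> mD mu0.
suff ge0 (g : T -> \bar R) : (forall x, (0 <= g x)%E) ->
    (\int[mu]_x g x = \int[mu]_x (g \_ D) x)%E.
  rewrite [LHS]integralE [RHS]integral_mkcond [RHS]integralE.
  by rewrite funepos_restrict funeneg_restrict -!ge0// => x; rewrite restrict_id.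
move=> g0.
have gD0 x : (0 <= (g \_ D) x)%E by rewrite erestrict_ge0.
(* Both integrals are suprema over simple functions below the integrand, a description valid for
   arbitrary nonnegative [g]. A simple [k] below [g] is cut down to [D] without changing its
   integral, since the complement of [D] is null. *)
rewrite !ge0_integralTE//; apply/eqP; rewrite eq_le; apply/andP; split.
  apply: ge_ereal_sup => _ [k /= kg <-].
  apply: ereal_sup_ubound => /=; exists (proj_nnsfun k mD).
    move=> x; rewrite -mrestrict !patchE.
    by case: ifPn.
  rewrite -!integralT_nnsfun.
  have mk (k' : {nnsfun T >-> R}) : measurable_fun setT (fun x => (k' x)%:E).
    by apply/measurable_EFinP; exact: measurable_funPT.
  have e (k' : {nnsfun T >-> R}) : (\int[mu]_x (k' x)%:E =
      \int[mu]_(x in D) (k' x)%:E)%E.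
    rewrite (@ge0_negligible_integral _ _ _ _ setT (~` D))//.
    - by rewrite setTD setCK.
    - exact: measurableC.
    - by move=> x _; rewrite lee_fin.
  by rewrite !e; apply: eq_integral => x xD; rewrite -mrestrict patchE xD.
apply: ge_ereal_sup => _ [k /= kg <-].
apply: ereal_sup_ubound => /=; exists k => // x.
apply: le_trans (kg x) _; rewrite patchE; case: ifPn => // _.
Qed.

(** * Finite mixtures of measures *)

Section mixture.
Context d (T : measurableType d) (R : realType) (C : nat).
Variables (q : 'I_C -> R) (P : 'I_C -> {measure set T -> \bar R}).
Hypothesis q0 : forall c, 0 <= q c.

(** [msum] sums a family indexed by natural numbers, so the components are extended by the zero
    measure beyond [C]. *)
Let term (i : nat) : {measure set T -> \bar R} :=
  if insub i is Some c then mscale (NngNum (q0 c)) (P c) else mzero.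

Let termE (c : 'I_C) : term c = mscale (NngNum (q0 c)) (P c).
Proof. by rewrite /term valK. Qed.

Let msumE A : (msum term C A = \sum_(c < C) (q c)%:E * P c A)%E.
Proof. by rewrite /msum; apply: eq_bigr => c _; rewrite termE. Qed.

Lemma mixture_probability : (forall c, P c setT = 1%E) -> \sum_(c < C) q c = 1 ->
  exists Q : probability T R,
    forall A, (Q A = \sum_(c < C) (q c)%:E * P c A)%E.
Proof.
move=> P1 q1.
have Q1 : msum term C setT = 1%E.
  rewrite msumE; under eq_bigr do rewrite P1 mule1.
  by rewrite sumEFin q1.
pose Q : probability T R := HB.pack (msum term C)
  (Measure_isProbability.Build _ _ _ (msum term C) Q1).
by exists Q => A; rewrite -msumE.
Qed.

Lemma ge0_integral_mixture (mu : {measure set T -> \bar R}) D (f : T -> \bar R) :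
    measurable D ->
    (forall A, measurable A -> A `<=` D -> mu A = \sum_(c < C) (q c)%:E * P c A)%E ->
    measurable_fun D f -> (forall x, D x -> 0 <= f x)%E ->
  (\int[mu]_(x in D) f x = \sum_(c < C) (q c)%:E * \int[P c]_(x in D) f x)%E.
Proof.
move=> mD muE mf f0.
rewrite (eq_measure_integral (msum term C)); last first.
  by move=> A mA AD; rewrite muE// -msumE.
rewrite ge0_integral_measure_sum//; apply: eq_bigr => c _.
by rewrite termE ge0_integral_mscale.
Qed.

Lemma integral_mixture (mu : {measure set T -> \bar R}) D (f : T -> \bar R) :
    measurable D ->
    (forall A, measurable A -> A `<=` D -> mu A = \sum_(c < C) (q c)%:E * P c A)%E ->
    (forall c, (P c).-integrable D f) -> measurable_fun D f ->
  (\int[mu]_(x in D) f x = \sum_(c < C) (q c)%:E * \int[P c]_(x in D) f x)%E.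
Proof.
move=> mD muE fi mf.
rewrite integralE !ge0_integral_mixture//; last 2 first.
- exact: measurable_funeneg.
- exact: measurable_funepos.
(* Integrability makes every negative part finite, so no indeterminate difference arises when
   subtraction is distributed over the weights and the sum. *)
under [RHS]eq_bigr => c _.
  rewrite integralE muleBr//; last first.
    by rewrite fin_num_adde_defl// fin_numN integrable_neg_fin_num.
  over.
rewrite big_split/= sumeN//.
move=> i j _ _; apply: fin_num_adde_defl.
by rewrite fin_numM// integrable_neg_fin_num.
Qed.

End mixture.

(** * Measures given by a density *)

Section density.
Context d (T : measurableType d) (R : realType).
Variables (nu : {measure set T -> \bar R}) (D : set T) (g : T -> R).
Hypotheses (mD : measurable D) (mg : measurable_fun D g).
Hypothesis g0 : forall x, D x -> 0 <= g x.

Let g0' x : D x -> (0 <= (g x)%:E)%E.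
Proof. by move=> Dx; rewrite lee_fin g0. Qed.

Let mgE : measurable_fun D (fun x => (g x)%:E).
Proof. exact/measurable_EFinP. Qed.

Lemma density_probability : (\int[nu]_(x in D) (g x)%:E = 1)%E ->
  exists P : probability T R,
    forall A, measurable A -> (P A = \int[nu]_(x in A `&` D) (g x)%:E)%E.
Proof.
move=> g1; pose m A := (\int[nu]_(x in A `&` D) (g x)%:E)%E.
have m0 : m set0 = 0%E by rewrite /m set0I integral_set0.
have m_ge0 A : (0 <= m A)%E by apply: integral_ge0 => x [_ /g0'].
have m_sa : semi_sigma_additive m.
  move=> F mF tF mUF; rewrite /m setI_bigcupl ge0_integral_bigcup//.
  - by apply: is_cvg_ereal_nneg_natsum_cond => n _ _; exact: m_ge0.
  - by move=> k; exact: measurableI.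
  - by apply: (measurable_funS mD) mgE => x [n _ []].
  - by move=> x [n _ [_ /g0']].
  - exact: trivIset_setIr.
pose mu : {measure set T -> \bar R} :=
  HB.pack m (isMeasure.Build _ _ _ m m0 m_ge0 m_sa).
have mu1 : mu setT = 1%E by rewrite /mu /= /m setTI.
pose P : probability T R := HB.pack m (isMeasure.Build _ _ _ m m0 m_ge0 m_sa)
  (Measure_isProbability.Build _ _ _ mu mu1).
by exists P.
Qed.

Variable P : {measure set T -> \bar R}.
Hypothesis PE : forall A, measurable A ->
  (P A = \int[nu]_(x in A `&` D) (g x)%:E)%E.

Lemma density_setC : P (~` D) = 0%E.
Proof. by rewrite PE ?setICl ?integral_set0//; exact: measurableC. Qed.

(** A simple function is a finite combination of indicators of its level sets, and on such sets [PE]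
    is exactly the claim. *)
Let density_nnsfun (h : {nnsfun T >-> R}) :
  (\int[P]_(x in D) (h x)%:E = \int[nu]_(x in D) ((h x)%:E * (g x)%:E))%E.
Proof.
under [LHS]eq_integral do rewrite fimfunE -fsumEFin//.
rewrite [LHS]ge0_integral_fsum//; last 2 first.
  - by move=> r; exact/measurable_EFinP/measurableT_comp.
  - by move=> n x _; rewrite EFinM nnfun_muleindic_ge0.
under [RHS]eq_integral => x xD.
  rewrite fimfunE -fsumEFin// ge0_mule_fsuml; last first.
    by move=> r; rewrite EFinM nnfun_muleindic_ge0.
  over.
rewrite [RHS]ge0_integral_fsum//; last 2 first.
  - move=> r; apply: emeasurable_funM => //.
    exact/measurable_EFinP/measurableT_comp.
  - by move=> n x Dx; rewrite mule_ge0 ?g0'// EFinM nnfun_muleindic_ge0.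
apply: eq_fsbigr => r; rewrite inE => -[t _ <-].
rewrite integralZl_indic_nnsfun//=.
under [RHS]eq_integral do rewrite EFinM -muleA.
rewrite [RHS]ge0_integralZl//.
- rewrite integral_indic//= PE; last exact: measurableI.
  congr (_ * _)%E; rewrite -setIA setIid setIC integral_mkcondr.
  by apply: eq_integral => x xD; rewrite epatch_indic muleC.
- apply: emeasurable_funM => //.
  exact/measurable_EFinP/measurable_funTS.
- by move=> x Dx; rewrite mule_ge0 ?g0'// lee_fin.
- by rewrite lee_fin.
Qed.

(** Monotone convergence on both sides carries the identity from simple functions to their
    increasing limit [f]; multiplication by [g] preserves monotonicity because [g] is nonnegative on
    [D]. *)
Lemma ge0_density_integral (f : T -> \bar R) : measurable_fun D f ->
    (forall x, D x -> 0 <= f x)%E ->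
  (\int[P]_(x in D) f x = \int[nu]_(x in D) (f x * (g x)%:E))%E.
Proof.
move=> mf f0; pose f_ := nnsfun_approx mD mf.
have f_cvg x : D x -> (f_ n x)%:E @[n --> \oo] --> f x.
  by move=> Dx; exact: cvg_nnsfun_approx.
have f_nd x a b : (a <= b)%N -> f_ a x <= f_ b x.
  by move=> ab; exact/lefP/nd_nnsfun_approx.
have mf_ n : measurable_fun D (fun x => (f_ n x)%:E).
  by apply/measurable_EFinP/measurable_funTS.
transitivity (limn (fun n => \int[P]_(x in D) (f_ n x)%:E)%E).
  rewrite -monotone_convergence//=.
  - apply: eq_integral => x /[!inE] xD; apply/esym/cvg_lim => //=.
    exact: f_cvg.
  - by move=> n x _; rewrite lee_fin.
  - by move=> x _ a b ab; rewrite lee_fin//; exact: f_nd.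
transitivity (limn (fun n => \int[nu]_(x in D) ((f_ n x)%:E * (g x)%:E))%E).
  by congr (limn _); apply/funext => n; exact: density_nnsfun.
rewrite -monotone_convergence//=.
- apply: eq_integral => x /[!inE] xD; apply/cvg_lim => //=.
  by apply: cvgeZr => //; exact: f_cvg.
- by move=> n; apply: emeasurable_funM => //; exact: mf_.
- by move=> n x Dx; rewrite mule_ge0 ?g0'// lee_fin.
- by move=> x Dx a b ab; rewrite lee_wpmul2r ?g0'// lee_fin; exact: f_nd.
Qed.

Lemma density_integrable (f : T -> \bar R) : measurable_fun D f ->
  P.-integrable D f <-> nu.-integrable D (fun x => f x * (g x)%:E)%E.
Proof.
move=> mf.
have mfg : measurable_fun D (fun x => f x * (g x)%:E)%E.
  exact: emeasurable_funM.
have E : (\int[P]_(x in D) `|f x| = \int[nu]_(x in D) `|f x * (g x)%:E|)%E.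
  rewrite ge0_density_integral//; last exact: measurableT_comp.
  by apply: eq_integral => x /[!inE] Dx; rewrite abseM (gee0_abs (g0' Dx)).
by split=> /integrableP[_ fi]; apply/integrableP; split => //; rewrite -?E// E.
Qed.

(** Multiplication by the nonnegative [g] commutes with taking positive and negative parts, so the
    nonnegative case applies to each part. *)
Lemma density_integral (f : T -> \bar R) : measurable_fun D f ->
  (\int[P]_(x in D) f x = \int[nu]_(x in D) (f x * (g x)%:E))%E.
Proof.
move=> mf; rewrite integralE [RHS]integralE.
rewrite !ge0_density_integral//; [|exact: measurable_funeneg|exact: measurable_funepos].
congr (_ - _)%E; apply: eq_integral => x /[!inE] Dx.
- by rewrite !funeposE maxe_pMl ?g0'// mul0e.
- by rewrite !funenegE maxe_pMl ?g0'// mul0e mulNe.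
Qed.

End density.

(** * Kullback-Leibler divergence from an explicit density *)

Section KL_density.
Local Open Scope ereal_scope.
Local Open Scope charge_scope.

(** The Radon-Nikodym derivative in [KL] is determined only up to null sets. It and [r] have equal
    integrals over all measurable subsets of [D], hence agree [P2]-almost everywhere there, and by
    domination [P1]-almost everywhere, which suffices for the integral of the logarithm. *)
Lemma KL_density d (T : measurableType d) (R : realType) (P1 P2 : probability T R)
    (D : set T) (r : T -> R) :
    measurable D -> measurable_fun D r -> (forall x, D x -> (0 <= r x)%R) ->
    (forall A, measurable A -> P1 A = \int[P2]_(x in A `&` D) (r x)%:E) ->
  KL P1 P2 = \int[P1]_(x in D) (ln (r x))%:E.
Proof.
move=> mD mr r0 P1E.
have dom : P1 `<< P2.
  apply/null_content_dominatesP => A mA A0; rewrite P1E//.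
  apply: null_set_integral; first exact: measurableI.
  - apply/measurable_EFinP; apply: measurable_funS mr => //.
  - by apply: (subset_measure0 _ _ _ A0) => //; exact: measurableI.
have domc : charge_of_finite_measure P1 `<< P2 := dom.
rewrite /KL asboolT//.
have P1D : P1 (~` D) = 0.
  by rewrite P1E ?setICl ?integral_set0//; exact: measurableC.
rewrite (integral_conull _ mD P1D).
set g := Radon_Nikodym _ _.
have mg : measurable_fun setT g.
  by apply: measurable_int; exact: (Radon_Nikodym_integrable domc).
have rg : ae_eq P2 D (EFin \o r) g.
  apply: ae_eq_sym; apply: integral_ae_eq => //.
  - apply: (@integrableS _ _ _ _ setT) => //.
    exact: (Radon_Nikodym_integrable domc).
  - exact/measurable_EFinP.
  - move=> E ED mE; rewrite -(Radon_Nikodym_integral domc)//.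
    by rewrite /charge_of_finite_measure/= P1E// (setIidl ED).
have mln (f : T -> R) : measurable_fun D f -> measurable_fun D (fun x => (ln (f x))%:E).
  by move=> mf; apply/measurable_EFinP; apply: measurableT_comp mf; exact: measurable_ln.
apply: ae_eq_integral => //.
- apply: mln; apply: measurableT_comp => //; exact: measurable_funTS.
- exact: mln.
- move: (null_dominates_ae_eq mD dom rg); apply: filterS => x /= rgx Dx.
  by rewrite -rgx.
Qed.

End KL_density.

(** * Inner product, and elementary bounds used for domination *)

Section dotp.
Context {R : realType} {p : nat}.
Implicit Types u v w : 'rV[R]_p.

Lemma dotpC u v : dotp u v = dotp v u.
Proof. by apply: eq_bigr => i _; rewrite mulrC. Qed.

Lemma dotpDl u v w : dotp (u + v) w = dotp u w + dotp v w.
Proof. by rewrite -big_split; apply: eq_bigr => i _; rewrite mxE mulrDl. Qed.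

Lemma dotpZl a u v : dotp (a *: u) v = a * dotp u v.
Proof. by rewrite mulr_sumr; apply: eq_bigr => i _; rewrite mxE mulrA. Qed.

Lemma dotpBl u v w : dotp (u - v) w = dotp u w - dotp v w.
Proof. by rewrite -scaleN1r dotpDl dotpZl mulN1r. Qed.

Lemma dotpNr u v : dotp u (- v) = - dotp u v.
Proof. by rewrite -scaleN1r dotpC dotpZl dotpC mulN1r. Qed.

Lemma dotp_delta i v : dotp (delta_mx ord0 i) v = v ord0 i.
Proof.
rewrite /dotp (bigD1 i)//= big1 ?addr0 ?mxE ?eqxx ?mul1r// => j ji.
by rewrite mxE (negbTE ji) andbF mul0r.
Qed.

End dotp.

(** Follows from $1+x\le e^x$ at $\pm tu$. With $u=\langle v,T(y)\rangle$ it trades a linear factor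
    for two exponentials, that is, for the parameters $\theta\pm tv$. *)
Lemma norm_le_expR_cosh (R : realType) (t u : R) : 0 < t ->
  `|u| <= t^-1 * (expR (t * u) + expR (- (t * u))).
Proof.
move=> t0; rewrite ler_pdivlMl// -{1}(gtr0_norm t0) -normrM.
have := expR_ge1Dx (t * u); have := expR_ge1Dx (- (t * u)).
have := expR_gt0 (t * u); have := expR_gt0 (- (t * u)).
by case: (ger0P (t * u)) => _; lra.
Qed.

Lemma expR_le_cosh (R : realType) (t s u : R) : `|s| <= t ->
  expR (s * u) <= expR (t * u) + expR (- (t * u)).
Proof.
rewrite ler_norml => /andP[ts st].
have [u0|/ltW u0] := leP 0 u.
  apply: le_trans (_ : _ <= expR (t * u)) _; last by rewrite lerDl expR_ge0.
  by rewrite ler_expR ler_wpM2r.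
apply: le_trans (_ : _ <= expR (- (t * u))) _; last by rewrite lerDr expR_ge0.
by rewrite ler_expR -mulNr ler_wnM2r.
Qed.

(** The two preceding bounds at [t / 2] multiply to a square $(a+b)^2\le 2(a^2+b^2)$ with
    $a,b=e^{\pm tu/2}$. Halving [t] leaves room for the linear factor. *)
Lemma norm_mul_expR_le_cosh (R : realType) (t s u : R) : 0 < t -> `|s| <= t / 2 ->
  `|u| * expR (s * u) <= (t / 2)^-1 * 2 * (expR (t * u) + expR (- (t * u))).
Proof.
move=> t0 st; have t20 : 0 < t / 2 by rewrite divr_gt0.
have sq x : expR (t * x) = expR (t / 2 * x) ^+ 2.
  by rewrite -expRM_natl; congr expR; field.
rewrite -mulrN !sq mulrN.
have h1 := norm_le_expR_cosh u t20; have h2 := expR_le_cosh u st.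
apply: le_trans (ler_pM (normr_ge0 _) (expR_ge0 _) h1 h2) _.
rewrite -!mulrA ler_wpM2l ?invr_ge0 ?(ltW t20)//.
set a := expR _; set b := expR _.
by have := sqr_ge0 (a - b); rewrite -subr_ge0; move: a b => a b; lra.
Qed.

(** Reduces a directional derivative to a derivative in one real variable, the setting of
    differentiation under the integral sign. *)
Lemma derive_line (R : realType) (V : normedModType R) (f : V -> R) (x v : V) :
  'D_v f x = 'D_1 (fun s : R => f (x + s *: v)) 0.
Proof.
rewrite /derive; set F := (X in lim (X @ _)); set G := (X in _ = lim (X @ _)).
suff -> : F = G by [].
by apply/funext => s; rewrite /F /G /= scaler1 addr0 scale0r addr0 [x + _]addrC.
Qed.

(** * Exponential families: partition function, means and divergences *)

Section exponential_family.
Context (R : realType) (m p : nat).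
Variables (Y : set (m.-tuple R)) (nu : {measure set (m.-tuple R) -> \bar R}).
Variables (h : m.-tuple R -> R) (T : m.-tuple R -> 'rV[R]_p).
Hypotheses (mY : measurable Y) (mh : measurable_fun Y h).
Hypothesis h0 : forall y, Y y -> 0 <= h y.
Hypothesis mT : forall i : 'I_p, measurable_fun Y (fun y => T y ord0 i).

Local Notation Z := (Zint nu Y h T).
Local Notation Psi := (Psi nu Y h T).
Local Notation Theta := (Theta nu Y h T).
Local Notation f := (fdens nu Y h T).
Implicit Types (th v : 'rV[R]_p).

Lemma measurable_dotp v : measurable_fun Y (fun y => dotp v (T y)).
Proof.
by apply: measurable_sum => i; apply: measurable_funM => //; exact: measurable_cst.
Qed.

Lemma measurable_expR_dotp v : measurable_fun Y (fun y => h y * expR (dotp v (T y))).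
Proof.
apply: measurable_funM => //.
by apply: measurableT_comp (measurable_dotp v); exact: measurable_expR.
Qed.

Lemma fdensE th y : f th y = h y * expR (dotp th (T y)) * expR (- Psi th).
Proof. by rewrite /fdens expRD mulrA. Qed.

Lemma fdens_ge0 th y : Y y -> 0 <= f th y.
Proof. by move=> Yy; rewrite mulr_ge0 ?h0 ?expR_ge0. Qed.

Lemma measurable_fdens th : measurable_fun Y (f th).
Proof.
rewrite (_ : f th = fun y => h y * expR (dotp th (T y)) * expR (- Psi th)).
  by apply: measurable_funM; [exact: measurable_expR_dotp|exact: measurable_cst].
by apply/funext => y; rewrite fdensE.
Qed.

Lemma Theta_integrable th : Theta th ->
  nu.-integrable Y (fun y => (h y * expR (dotp th (T y)))%:E).
Proof.
move=> Tth; apply/integrableP; split.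
  by apply/measurable_EFinP; exact: measurable_expR_dotp.
rewrite (eq_integral (fun y => (h y * expR (dotp th (T y)))%:E))// => y /[!inE] Yy.
by rewrite gee0_abs// lee_fin mulr_ge0 ?h0 ?expR_ge0.
Qed.

Lemma Zint_ge0 th : (0 <= Z th)%E.
Proof. by apply: integral_ge0 => y Yy; rewrite lee_fin mulr_ge0 ?h0 ?expR_ge0. Qed.

Lemma Zint_fin_num th : Theta th -> Z th \is a fin_num.
Proof. by move=> Tth; rewrite ge0_fin_numE// Zint_ge0. Qed.

(** If the integral vanished, then [h] would be zero almost everywhere on [Y], as exponentials are
    positive; every density of the family would then have mass zero, contradicting the existence of
    [P]. *)
Lemma Zint_gt0 (P : probability (m.-tuple R) R) th0 th :
  has_density nu Y (f th0) P -> (0 < Z th)%E.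
Proof.
move=> Pd; rewrite lt_neqAle Zint_ge0 andbT eq_sym; apply/eqP => Z0.
have ae0 : ae_eq nu Y (fun y => (h y * expR (dotp th (T y)))%:E) (cst 0%E).
  apply/ae_eq_integral_abs => //; first by apply/measurable_EFinP; exact: measurable_expR_dotp.
  rewrite -Z0; apply: eq_integral => y /[!inE] Yy.
  by rewrite gee0_abs// lee_fin mulr_ge0 ?h0 ?expR_ge0.
have : P setT = 0%E.
  rewrite Pd// setTI (ae_eq_integral (cst 0%E)) ?integral0//.
  - by apply/measurable_EFinP; exact: measurable_fdens.
  - move: ae0; apply: filterS => y /= hy Yy; move: (hy Yy) => -[/eqP].
    by rewrite mulf_eq0 (gt_eqF (expR_gt0 _)) orbF /fdens => /eqP ->; rewrite mul0r.
by rewrite probability_setT => /eqP; rewrite onee_eq0.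
Qed.

Hypothesis Z_gt0 : forall th, (0 < Z th)%E.

Lemma fine_Zint_gt0 th : Theta th -> 0 < fine (Z th).
Proof. by move=> Tth; rewrite fine_gt0// Z_gt0. Qed.

Lemma expR_Psi th : Theta th -> expR (Psi th) = fine (Z th).
Proof. by move=> Tth; rewrite lnK// posrE fine_Zint_gt0. Qed.

Lemma integral_fdens th : Theta th -> (\int[nu]_(y in Y) (f th y)%:E = 1)%E.
Proof.
move=> Tth; under eq_integral do rewrite fdensE mulrC EFinM.
rewrite integralZl//; last exact: Theta_integrable.
rewrite -/(Zint nu Y h T th) -(fineK (Zint_fin_num Tth)) -EFinM expRN expR_Psi//.
by rewrite mulVf// gt_eqF// fine_Zint_gt0.
Qed.

Lemma exp_family_probability th : Theta th ->
  exists P : probability (m.-tuple R) R, has_density nu Y (f th) P.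
Proof.
move=> Tth; apply: density_probability => //.
- exact: measurable_fdens.
- by move=> y; exact: fdens_ge0.
- exact: integral_fdens.
Qed.

Hypothesis Theta_open : open Theta.

Lemma Theta_segment th v : Theta th ->
  exists2 t : R, 0 < t & forall s, `|s| <= t -> Theta (th + s *: v).
Proof.
move=> Tth.
have cv : {for 0, continuous (fun s : R => th + s *: v)}.
  by apply: cvgD; [exact: cvg_cst|apply: cvgZr_tmp; exact: cvg_id].
have : nbhs (th + 0 *: v) Theta.
  by rewrite scale0r addr0; apply: open_nbhs_nbhs.
(* Halving the radius turns the open ball into the closed condition [|s| <= t]. *)
move=> /cv /nbhs_ballP[e /= e0 eT]; exists (e / 2); first by rewrite divr_gt0.
move=> s se; apply: eT; rewrite /ball/= sub0r normrN.
by apply: le_lt_trans se _; rewrite ltr_pdivrMr// ltr_pMr// ltr1n.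
Qed.

Lemma expR_dotpD th v s y :
  expR (dotp (th + s *: v) (T y)) = expR (dotp th (T y)) * expR (s * dotp v (T y)).
Proof. by rewrite dotpDl dotpZl expRD. Qed.

(** Up to the constant [a], the function is the sum of the unnormalised densities at [th + t *: v]
    and [th - t *: v]; it is the dominating function in what follows. *)
Lemma integrable_bound th v t : Theta (th + t *: v) -> Theta (th + (- t) *: v) ->
  forall a : R, nu.-integrable Y (fun y => (a * (h y * expR (dotp th (T y)) *
    (expR (t * dotp v (T y)) + expR (- (t * dotp v (T y))))))%:E).
Proof.
move=> Tt TNt a; under eq_fun do rewrite EFinM.
apply: integrableZl => //.
rewrite (_ : (fun y => _) = (fun y => (h y * expR (dotp (th + t *: v) (T y)))%:E)
   \+ (fun y => (h y * expR (dotp (th + (- t) *: v) (T y)))%:E))%E.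
  by apply: integrableD => //; exact: Theta_integrable.
apply/funext => y /=; rewrite !expR_dotpD mulNr -EFinD; congr EFin.
by rewrite mulrDr !mulrA.
Qed.

Lemma integrable_dotp_expR th v : Theta th ->
  nu.-integrable Y (fun y => (dotp v (T y) * (h y * expR (dotp th (T y))))%:E).
Proof.
move=> /Theta_segment -/(_ v)[t t0 Tt].
have Tt1 : Theta (th + t *: v) by apply: Tt; rewrite gtr0_norm.
have Tt2 : Theta (th + (- t) *: v) by apply: Tt; rewrite normrN gtr0_norm.
apply: le_integrable (integrable_bound Tt1 Tt2 t^-1) => //.
  apply/measurable_EFinP/measurable_funM; first exact: measurable_dotp.
  exact: measurable_expR_dotp.
move=> y Yy /=; rewrite lee_fin normrM.
have hy0 : 0 <= h y * expR (dotp th (T y)) by rewrite mulr_ge0 ?h0 ?expR_ge0.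
rewrite (ger0_norm hy0) [leRHS]ger0_norm; last first.
  by rewrite mulr_ge0 ?invr_ge0 ?(ltW t0)// mulr_ge0// addr_ge0 ?expR_ge0.
by rewrite mulrC [leRHS]mulrCA ler_wpM2l// norm_le_expR_cosh.
Qed.

(** Differentiation under the integral sign on $|s|<t/2$, where $\theta\pm tv$ are still in [Theta]:
    there the derivative of the integrand is dominated through [norm_mul_expR_le_cosh]. *)
Lemma is_derive_Zint th v : Theta th ->
  is_derive (0 : R) 1 (fun s => fine (Z (th + s *: v)))
    (\int[nu]_(y in Y) (dotp v (T y) * (h y * expR (dotp th (T y))))).
Proof.
move=> /Theta_segment -/(_ v)[t t0 Tt].
pose g (s : R) (y : m.-tuple R) := h y * expR (dotp (th + s *: v) (T y)).
have dg (s : R) (y : m.-tuple R) : is_derive s 1 (g ^~ y) (dotp v (T y) * g s y).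
  rewrite (_ : g ^~ y = fun s => (h y * expR (dotp th (T y))) *
      (expR \o (fun s => s * dotp v (T y))) s); last first.
    by apply/funext => x; rewrite /g expR_dotpD mulrA.
  apply: is_derive_eq.
  rewrite /g expR_dotpD /= /GRing.scale/= .
  ring.
have t20 : 0 < t / 2 by rewrite divr_gt0.
have I0 : `]- (t / 2), t / 2[%classic 0 by rewrite /= in_itv/= oppr_lt0 t20.
have Tt1 : Theta (th + t *: v) by apply: Tt; rewrite gtr0_norm.
have Tt2 : Theta (th + (- t) *: v) by apply: Tt; rewrite normrN gtr0_norm.
have hy0 y : Y y -> 0 <= h y * expR (dotp th (T y)).
  by move=> Yy; rewrite mulr_ge0 ?h0 ?expR_ge0.
(* The absolute value makes [G] nonnegative everywhere, while [h] is known to be so on [Y] only. *)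
pose G y := `|(t / 2)^-1 * 2 * (h y * expR (dotp th (T y)) *
    (expR (t * dotp v (T y)) + expR (- (t * dotp v (T y)))))|.
have intg s : `]- (t / 2), t / 2[%classic s -> nu.-integrable Y (EFin \o g s).
  rewrite /= in_itv/= => /andP[s1 s2]; apply: Theta_integrable; apply: Tt.
  rewrite ler_norml; apply/andP; split; lra.
have dge s y : partial1of2 g s y = dotp v (T y) * g s y.
  by rewrite partial1of2E; apply: derive_val.
have Gub s y : `]- (t / 2), t / 2[%classic s -> Y y -> `|partial1of2 g s y| <= G y.
  rewrite /= in_itv/= => /andP[s1 s2] Yy; rewrite dge /g expR_dotpD.
  apply: le_trans (ler_norm _).
  set u := dotp v (T y); set b := expR (dotp th (T y)).
  have -> : u * (h y * (b * expR (s * u))) = h y * b * (u * expR (s * u)) by ring.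
  rewrite normrM (ger0_norm (hy0 _ Yy)) [leRHS]mulrCA ler_wpM2l ?hy0// normrM.
  rewrite (gtr0_norm (expR_gt0 _)).
  rewrite norm_mul_expR_le_cosh// ler_norml; apply/andP; split; lra.
have intG : nu.-integrable Y (EFin \o G).
  have := integrable_bound Tt1 Tt2 ((t / 2)^-1 * 2).
  by move=> /integrable_abse.
have derg s y : `]- (t / 2), t / 2[%classic s -> Y y -> derivable (g ^~ y) s 1.
  by move=> _ _; apply: ex_derive.
have eqF : (fun s => fine (Z (th + s *: v))) = (fun s => \int[nu]_(y in Y) g s y) by [].
rewrite eqF; apply: DeriveDef.
  exact: (derivable_under_integral mY I0 intg derg (fun y => normr_ge0 _) intG Gub).
rewrite -derive1E.
rewrite (differentiation_under_integral mY I0 intg derg (fun y => normr_ge0 _) intG Gub).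
by apply: eq_Rintegral => y _; rewrite dge /g scale0r addr0.
Qed.

(** Chain rule for the logarithm of the partition function; the factor [expR (- Psi th)] is its
    reciprocal. *)
Lemma derive_Psi th v : Theta th ->
  'D_v Psi th = expR (- Psi th) *
    \int[nu]_(y in Y) (dotp v (T y) * (h y * expR (dotp th (T y)))).
Proof.
move=> Tth; have dZ := is_derive_Zint v Tth.
have Z0 : 0 < fine (Z (th + 0 *: v)) by rewrite scale0r addr0 fine_Zint_gt0.
have dlnZ := is_derive1_comp (is_derive1_ln Z0) dZ.
case: dlnZ => _ dE; set I := Rintegral _ _ _ in dE *.
have -> : expR (- Psi th) * I = (fine (Z (th + 0 *: v)))^-1 * I.
  by rewrite scale0r addr0 expRN expR_Psi.
by rewrite -dE derive_line.
Qed.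

Variables (th : 'rV[R]_p) (Q : probability (m.-tuple R) R).
Hypotheses (Tth : Theta th) (Qd : has_density nu Y (f th) Q).

Lemma integrable_dotp v : Q.-integrable Y (fun y => (dotp v (T y))%:E).
Proof.
have mf := measurable_fdens th.
apply/(density_integrable mY mf (@fdens_ge0 th) Qd).
  by apply/measurable_EFinP; exact: measurable_dotp.
under eq_fun do rewrite -EFinM fdensE mulrA mulrC EFinM.
apply: integrableZl => //.
exact: integrable_dotp_expR.
Qed.

Lemma integral_dotp v : (\int[Q]_(y in Y) (dotp v (T y))%:E = (dotp (grad Psi th) v)%:E)%E.
Proof.
have mf := measurable_fdens th.
have Ed w : (\int[Q]_(y in Y) (dotp w (T y))%:E = ('D_w Psi th)%:E)%E.
  rewrite (density_integral mY mf (@fdens_ge0 th) Qd); last first.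
    by apply/measurable_EFinP; exact: measurable_dotp.
  under eq_integral do rewrite -EFinM fdensE mulrA mulrC EFinM.
  rewrite integralZl//; last exact: integrable_dotp_expR.
  rewrite derive_Psi// EFinM /Rintegral fineK//.
  by apply: integrable_fin_num => //; exact: integrable_dotp_expR.
(* [grad] records partial derivatives only, so linearity in [v] is taken from the integral:
   [dotp v (T y)] is expanded in coordinates and the directional formula is used along each basis
   vector. *)
under eq_integral => y _.
  rewrite /dotp -sumEFin; under eq_bigr => i _ do rewrite -(dotp_delta i (T y)) EFinM.
  over.
rewrite integral_sum//; last first.
  by move=> i; apply: integrableZl => //; exact: integrable_dotp.
rewrite -sumEFin; apply: eq_bigr => i _.
by rewrite integralZl//; [rewrite Ed -EFinM mulrC mxE|exact: integrable_dotp].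
Qed.

Let integral_cst_conull a : (\int[Q]_(y in Y) a%:E = a%:E)%E.
Proof.
have QC : Q (~` Y) = 0%E := density_setC mY Qd.
have := probability_setC Q (measurableC mY).
rewrite setCK QC sube0 integral_cst// => QY.
by rewrite -[RHS]mule1; congr (_ * _)%E; exact: QY.
Qed.

Lemma integral_affine v a :
  (\int[Q]_(y in Y) (dotp v (T y) + a)%:E = (dotp (grad Psi th) v + a)%:E)%E.
Proof.
under eq_integral do rewrite EFinD.
rewrite integralD//.
- by rewrite integral_dotp integral_cst_conull.
- exact: integrable_dotp.
- exact: finite_measure_integrable_cst.
Qed.

(** The factor [h] cancels in the ratio [r] of the two densities, whose logarithm is therefore
    affine in [T]; its mean under [Q] is read off from the gradient of [Psi]. *)
Lemma KL_exp_family th' (P : probability (m.-tuple R) R) :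
    Theta th' -> has_density nu Y (f th') P ->
  (KL Q P = (dotp (grad Psi th) (th - th') - Psi th + Psi th')%:E)%E.
Proof.
move=> Tth' Pd.
pose r y := expR (dotp (th - th') (T y) + (Psi th' - Psi th)).
have mdot : measurable_fun Y (fun y => dotp (th - th') (T y) + (Psi th' - Psi th)).
  by apply: measurable_funD; [exact: measurable_dotp|exact: measurable_cst].
have mr : measurable_fun Y r by apply: measurableT_comp mdot; exact: measurable_expR.
rewrite (@KL_density _ _ _ _ _ Y r)//.
- under eq_integral do rewrite expRK.
  by rewrite integral_affine; congr EFin; rewrite addrA addrAC.
- by move=> y _; exact: expR_ge0.
- move=> A mA; rewrite Qd// setIC !integral_mkcondr.
  have mA' : measurable_fun Y ((EFin \o r) \_ A).
    apply/(measurable_restrict _ mA mY).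
    by apply: measurable_funS (_ : measurable_fun Y _) => //; apply/measurable_EFinP.
  rewrite (density_integral mY (measurable_fdens th') (@fdens_ge0 th') Pd)//.
  apply: eq_integral => y _; rewrite !patchE; case: ifPn => // _; last by rewrite mul0e.
  rewrite -EFinM /fdens /r mulrCA -expRD; congr (_ * expR _)%:E.
  rewrite dotpBl; move: (dotp th _) (dotp th' _) (Psi th) (Psi th') => a b c e.
  by ring.
Qed.

(** The right-hand side is the divergence from [th] to [th'], the mean under [Q] of the log-ratio
    [a]. Integrating $1-e^{-a}\le a$ gives the sign, because $e^{-a}$ turns the density at [th] into
    the one at [th'] and so has mean 1. *)
Lemma KL_exp_family_ge0 th' : Theta th' ->
  0 <= dotp (grad Psi th) (th - th') - Psi th + Psi th'.
Proof.
move=> Tth'.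
pose a y := dotp (th - th') (T y) + (Psi th' - Psi th).
have ma : measurable_fun Y a.
  by apply: measurable_funD; [exact: measurable_dotp|exact: measurable_cst].
have me : measurable_fun Y (fun y => (expR (- a y))%:E).
  apply/measurable_EFinP; apply: measurableT_comp; first exact: measurable_expR.
  exact: measurableT_comp.
have e y : expR (- a y) * f th y = f th' y.
  rewrite /fdens mulrCA -expRD /a dotpBl; congr (_ * expR _).
  by move: (dotp th _) (dotp th' _) (Psi th) (Psi th') => b c k l; ring.
have ie : (\int[Q]_(y in Y) (expR (- a y))%:E = 1)%E.
  rewrite (density_integral mY (measurable_fdens th) (@fdens_ge0 th) Qd)//.
  under eq_integral do rewrite -EFinM e.
  exact: integral_fdens.
have inte : Q.-integrable Y (fun y => (expR (- a y))%:E).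
  apply/integrableP; split => //.
  under eq_integral do rewrite gee0_abs ?lee_fin ?expR_ge0//.
  by rewrite ie ltry.
have inta : Q.-integrable Y (fun y => (a y)%:E).
  under eq_fun do rewrite EFinD.
  apply: integrableD => //; first exact: integrable_dotp.
  exact: finite_measure_integrable_cst.
have int1 : Q.-integrable Y (fun y => (1 - expR (- a y))%:E).
  under eq_fun do rewrite EFinB.
  by apply: integrableB => //; exact: finite_measure_integrable_cst.
have : (\int[Q]_(y in Y) (1 - expR (- a y))%:E <= \int[Q]_(y in Y) (a y)%:E)%E.
  apply: le_integral => // y _; rewrite lee_fin.
  by have := expR_ge1Dx (- a y); lra.
rewrite integral_affine; under eq_integral do rewrite EFinB.
rewrite integralB//; last exact: finite_measure_integrable_cst.
rewrite integral_cst_conull ie subee// lee_fin.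
by move: (Psi th) (Psi th') => b c; rewrite addrA addrAC.
Qed.

End exponential_family.

(** * Measures carried by finitely many atoms, or by the slices above them *)

Lemma measure_setI_conull d (T : measurableType d) (R : realType)
    (P : {measure set T -> \bar R})
    (A S : set T) : measurable A -> measurable S -> P (~` S) = 0%E ->
  P A = P (A `&` S).
Proof.
move=> mA mS PS.
have mAS : measurable (A `&` ~` S) by apply: measurableI => //; exact: measurableC.
rewrite -[in LHS](setIT A) -(setUv S) setIUr measureU//; last 2 first.
- exact: measurableI.
- by rewrite setIACA setICr setI0.
rewrite [X in (_ + X)%E](_ : _ = 0%E) ?adde0//.
by apply: subset_measure0 PS => //; exact: measurableC.
Qed.

Section discrete.
Context d (X : measurableType d) (R : realType) (C : nat) (xh : 'I_C -> X).
Hypotheses (xh_inj : injective xh) (mxh : forall c, measurable [set xh c]).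

Lemma measurable_range : measurable (range xh).
Proof.
rewrite (_ : range xh = \bigcup_(c in setT) [set xh c]).
  by apply: fin_bigcup_measurable => //; exact: finite_finset.
by apply/seteqP; split => [_ [c _ <-]|x [c _ ->]]; exists c.
Qed.

Let sum_xh (a : 'I_C -> R) c : \sum_(c' < C) a c' * \1_[set xh c'] (xh c) = a c.
Proof.
rewrite (bigD1 c)//= big1 ?addr0 ?indicE ?mem_set ?mulr1// => c' c'c.
rewrite indicE memNset ?mulr0//= => /xh_inj cc'.
by rewrite cc' eqxx in c'c.
Qed.

Lemma sum_dirac_set1 (q : 'I_C -> R) c :
  (\sum_(c' < C) (q c')%:E * \d_(xh c') [set xh c] = (q c)%:E)%E.
Proof.
rewrite (bigD1 c)//= diracE mem_set// mule1 big1 ?adde0// => c' c'c.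
rewrite diracE memNset ?mule0//= => /xh_inj cc'.
by rewrite cc' eqxx in c'c.
Qed.

Lemma integral_discrete (P : probability X R) (q : 'I_C -> R) D (f : X -> R) :
    (forall c, 0 <= q c) ->
    (forall A, measurable A -> (P A = \sum_(c < C) (q c)%:E * \d_(xh c) A)%E) ->
    measurable D -> measurable_fun D f ->
  (\int[P]_(x in D) (f x)%:E = \sum_(c < C) (q c)%:E * (\d_(xh c) D * (f (xh c))%:E))%E.
Proof.
move=> q0 PE mD mf.
have mfE : measurable_fun D (fun x => (f x)%:E) by exact/measurable_EFinP.
rewrite (integral_mixture (q := q) (P := fun c => \d_(xh c)))//.
- by apply: eq_bigr => c _; rewrite integral_dirac.
- by move=> A mA _; exact: PE.
- move=> c; apply/integrableP; split => //.
  rewrite integral_dirac//; last exact: measurableT_comp.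
  by rewrite diracE -EFinM ltry.
Qed.

Lemma measure_discrete (P : probability X R) : P (~` range xh) = 0%E ->
  forall A, measurable A -> (P A = \sum_(c < C) P [set xh c] * \d_(xh c) A)%E.
Proof.
move=> P0 A mA.
transitivity (P (\big[setU/set0]_(c < C) (A `&` [set xh c]))).
  rewrite -big_distrr/= (measure_setI_conull mA measurable_range P0); congr (P (_ `&` _)).
  rewrite -bigcup_seq; apply/seteqP; split => [_ [c _ <-]|x [c _ ->]].
    by exists c => //=; rewrite mem_index_enum.
  by exists c.
rewrite measure_bigsetU_ord//; last 2 first.
- by move=> c; exact: measurableI.
- by move=> i j _ _ [x [[_ ->] [_ /xh_inj]]].
apply: eq_bigr => c _; rewrite diracE; have [Ax|Ax] := boolP (_ \in _).
  rewrite mule1; congr (P _); apply/seteqP; split => [x []//|x ->].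
  by split=> //; rewrite inE in Ax.
rewrite mule0 (_ : _ `&` _ = set0) ?measure0//.
by apply/seteqP; split => // x [] /[swap] -> Ax'; move: Ax; rewrite notin_setE.
Qed.

(** The density [r] takes the value [q c / p c] at [xh c] and 0 elsewhere. Where [p c] vanishes so
    does [q c], and the term contributes 0. *)
Lemma KL_discrete (Q P : probability X R) (q p : 'I_C -> R) :
    (forall c, 0 <= q c) -> (forall c, 0 <= p c) -> (forall c, p c = 0 -> q c = 0) ->
    (forall A, measurable A -> (Q A = \sum_(c < C) (q c)%:E * \d_(xh c) A)%E) ->
    (forall A, measurable A -> (P A = \sum_(c < C) (p c)%:E * \d_(xh c) A)%E) ->
  (KL Q P = (\sum_(c < C) q c * ln (q c / p c))%:E)%E.
Proof.
move=> q0 p0 pq QE PE.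
pose r x := \sum_(c < C) q c / p c * \1_[set xh c] x.
have mr : measurable_fun setT r.
  by apply: measurable_sum => c; apply: measurable_funM => //; exact: measurable_indic.
rewrite (@KL_density _ _ _ _ _ setT r)//.
- rewrite (integral_discrete q0 QE)//; last exact: measurableT_comp.
  rewrite -sumEFin; apply: eq_bigr => c _.
  by rewrite diracT mul1e /r sum_xh.
- by move=> x _; apply: sumr_ge0 => c _; rewrite mulr_ge0 ?divr_ge0.
- move=> A mA; rewrite setIT (integral_discrete p0 PE)//; last exact: measurable_funTS.
  rewrite QE//; apply: eq_bigr => c _; rewrite /r sum_xh [RHS]muleCA [RHS]muleC.
  congr (_ * _)%E; rewrite -EFinM; congr EFin.
  have [pc0|pc0] := eqVneq (p c) 0; first by rewrite pq// mul0r mulr0.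
  by rewrite mulrC divfK.
Qed.

Section slices.
Context d' (Y : measurableType d').
Variables (q : 'I_C -> R) (q0 : forall c, 0 <= q c).
Variables (PY : 'I_C -> probability Y R).

Let mp c : measurable_fun setT (pair (xh c) : Y -> X * Y).
Proof. exact: pair1_measurable. Qed.

(** The product of the Dirac mass at [xh c] with [PY c], encoded as an image measure. *)
Let slice (c : 'I_C) : {measure set (X * Y) -> \bar R}.
Proof. by refine (pushforward (PY c) (pair (xh c))); exact: mp. Defined.

Lemma slices_probability : \sum_(c < C) q c = 1 ->
  exists Q : probability (X * Y)%type R,
    forall E, (Q E = \sum_(c < C) (q c)%:E * PY c [set y | E (xh c, y)])%E.
Proof. by apply: (mixture_probability q0 (P := slice)) => c; exact: probability_setT. Qed.

Variable Q : probability (X * Y)%type R.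

(** The weights [q] sum to 1, so the slices above the atoms carry all the mass of [Q], and the
    values on them determine [Q]. *)
Lemma measure_slices : \sum_(c < C) q c = 1 ->
    (forall c A, measurable A -> (Q ([set xh c] `*` A) = (q c)%:E * PY c A)%E) ->
  forall E, measurable E -> (Q E = \sum_(c < C) (q c)%:E * PY c [set y | E (xh c, y)])%E.
Proof.
move=> q1 Qc E mE.
pose S : set (X * Y) := \big[setU/set0]_(c < C) ([set xh c] `*` setT).
have mS c : measurable ([set xh c] `*` [set: Y]) by exact: measurableX.
have tS : trivIset setT (fun c => [set xh c] `*` [set: Y]).
  by move=> i j _ _ [[x y] [/= [-> _] [/xh_inj]]].
have mSS : measurable S by exact: bigsetU_measurable.
have QS : Q S = 1%E.
  rewrite /S measure_bigsetU_ord//.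
  rewrite (eq_bigr (fun c => (q c)%:E)) ?sumEFin ?q1// => c _.
  by rewrite -[RHS]mule1 -(probability_setT (PY c)); exact: Qc.
have QSC : Q (~` S) = 0%E by rewrite probability_setC// QS subee.
rewrite (measure_setI_conull mE mSS QSC) /S big_distrr/= measure_bigsetU_ord//; last 2 first.
- by move=> c; exact: measurableI.
- exact: trivIset_setIl.
apply: eq_bigr => c _; rewrite -Qc; last first.
  by rewrite -[X in measurable X]setTI; exact: (pair1_measurable (xh c)).
congr (Q _); apply/seteqP; split => [[x y] /= [Exy [xc _]]|[x y] /= [->]]//.
by rewrite -xc.
Qed.

Lemma expectation_slices (D : set Y) (L : X * Y -> R) (g : 'I_C -> Y -> R) :
    (forall E, measurable E -> (Q E = \sum_(c < C) (q c)%:E * PY c [set y | E (xh c, y)])%E) ->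
    measurable D -> (forall c, PY c (~` D) = 0%E) ->
    (forall c y, D y -> L (xh c, y) = g c y) ->
    (forall c, (PY c).-integrable D (EFin \o g c)) ->
  (\int[Q]_z (L z)%:E = \sum_(c < C) (q c)%:E * \int[PY c]_(y in D) (g c y)%:E)%E.
Proof.
move=> QE mD PD Lg gi.
have mS : measurable (range xh `*` D).
  by apply: measurableX => //; exact: measurable_range.
have QS : Q (~` (range xh `*` D)) = 0%E.
  rewrite QE; last exact: measurableC.
  rewrite big1// => c _; rewrite (_ : [set y | _] = ~` D) ?PD ?mule0//.
  apply/seteqP; split => y /=; first by move=> + Dy; apply; split => //; exists c.
  by move=> Dy [].
(* [L] is controlled only on [range xh] times [D], a set of full measure. [L'] is a measurable
   function on the whole product that agrees with [L] there. *)
pose L' (z : X * Y) := \sum_(c < C) ((g c \_ D) z.2) * \1_[set xh c] z.1.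
have mgD c : measurable_fun setT (g c \_ D).
  by apply/(measurable_restrictT _ mD); move/measurable_int : (gi c) => /measurable_EFinP.
have mL' : measurable_fun setT L'.
  apply: measurable_sum => c; apply: measurable_funM.
    exact: (measurableT_comp (mgD c) measurable_snd).
  apply: (measurableT_comp _ measurable_fst); exact: measurable_indic.
have mL'E : measurable_fun setT (fun z => (L' z)%:E) by exact/measurable_EFinP.
rewrite (integral_conull _ mS QS).
rewrite (eq_integral (fun z => (L' z)%:E)); last first.
  move=> [x y] /[!inE]/= -[[c _ xc] Dy]; rewrite -xc.
  by rewrite Lg// /L'/= sum_xh patchE mem_set.
rewrite -(integral_conull _ mS QS).
have gi' c : (PY c).-integrable setT ((fun z => (L' z)%:E) \o pair (xh c)).
  rewrite (_ : _ \o _ = (EFin \o g c) \_ D).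
    by have := gi c; rewrite (integrable_mkcond _ mD).
  apply/funext => y /=; rewrite /L'/= sum_xh !patchE; by case: ifPn.
rewrite (integral_mixture q0 (P := slice))//.
- apply: eq_bigr => c _; rewrite (integral_pushforward (mp c) mL'E (gi' c))//.
  rewrite [in RHS]integral_mkcond; congr (_ * _)%E; apply: eq_integral => y _.
  by rewrite /= /L'/= sum_xh !patchE; case: ifPn.
- by move=> A mA _; exact: QE.
- by move=> c; exact: (integrable_pushforward (mp c) mL'E (gi' c)).
Qed.

End slices.
End discrete.

Lemma measurable_tuple_set1 (R : realType) (n : nat) (x : n.-tuple R) :
  measurable [set x].
Proof.
rewrite (_ : [set x] = \bigcap_(i in [set: 'I_n]) ((@tnth n R)^~ i @^-1` [set tnth x i])).
  apply: fin_bigcap_measurable => [|i _]; first exact: finite_finset.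
  by rewrite -[X in measurable X]setTI; exact: measurable_tnth.
apply/seteqP; split => [y -> //|y yx]; apply: eq_from_tnth => i.
exact: yx.
Qed.

(** * Optimality inequalities and the worst-case distribution *)

(** Termwise, $1+x\le e^x$ at $x=\phi_c-\ln(q_c/p_c)$, multiplied by $q_c$, bounds the difference of
    the two terms by $p_ce^{\phi_c}-q_c$, and these bounds sum to 0. *)
Lemma gibbs_inequality (R : realType) (C : nat) (q ph phi : 'I_C -> R) :
    (forall c, 0 <= q c) -> (forall c, 0 <= ph c) -> (forall c, ph c = 0 -> q c = 0) ->
    \sum_(c < C) q c = 1 -> \sum_(c < C) ph c * expR (phi c) = 1 ->
  \sum_(c < C) q c * phi c <= \sum_(c < C) q c * ln (q c / ph c).
Proof.
move=> q0 ph0 phq q1 p1; rewrite -subr_le0 -sumrB.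
suff h c : q c * phi c - q c * ln (q c / ph c) <= ph c * expR (phi c) - q c.
  by apply: le_trans (ler_sum _ (fun c _ => h c)) _; rewrite sumrB q1 p1 subrr.
have [qc0|qc0] := eqVneq (q c) 0.
  by rewrite qc0 !mul0r !subr0 mulr_ge0 ?expR_ge0.
have qc : 0 < q c by rewrite lt_neqAle eq_sym qc0 q0.
have pc : 0 < ph c.
  by rewrite lt_neqAle ph0 andbT; apply: contra_neq qc0 => /esym/phq.
have := expR_ge1Dx (phi c - ln (q c / ph c)).
rewrite expRD expRN lnK ?posrE ?divr_gt0// invf_div => le1.
have -> : ph c * expR (phi c) = q c * (expR (phi c) * (ph c / q c)).
  by field; rewrite gt_eqF.
have := ler_wpM2l (q0 c) le1; rewrite mulrDr mulr1 mulrBr.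
by move: (q c * phi c) (q c * ln _) (q c * (_ * _)) => a b e; lra.
Qed.

(** Here [G] and [Gs] stand for the gradients of [Psi] at a competitor [th] and at the tilted
    parameter, [a], [b], [e] for the values of [Psi] at the tilted, competing and nominal
    parameters, and [g] for $1/\gamma$. The last two hypotheses say that the divergence to the
    tilted density is nonnegative and the one to the nominal density at most [r]; together they give
    $g\langle G,l\rangle\ge e-r-a$, and the equation for [g] identifies the right-hand side. *)
Lemma dual_bound (R : realType) (p : nat) (G Gs l th thh : 'rV[R]_p)
    (g a b e r : R) : 0 < g -> a + g * dotp Gs l = e - r ->
    0 <= dotp G (th - (thh - g *: l)) - b + a -> dotp G (th - thh) - b + e <= r ->
  dotp Gs l <= dotp G l.
Proof.
move=> g0 gE; rewrite opprB [g *: l - _]addrC addrA dotpC dotpDl dotpZl.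
rewrite ![dotp (th - thh) _]dotpC [dotp l _]dotpC => le1 le2.
by rewrite -(ler_pM2l g0); lra.
Qed.

Unset Implicit Arguments.

Theorem theorem4p5 (R : realType) (n m p k C : nat)
  (* exponential family on Ysp ⊆ R^m *)
  (Ysp : set (m.-tuple R)) (nu : {measure set (m.-tuple R) -> \bar R})
  (h : m.-tuple R -> R) (T : m.-tuple R -> 'rV[R]_p)
  (mY : measurable Ysp)
  (mh : measurable_fun Ysp h) (h0 : forall y, Ysp y -> 0 <= h y)
  (mT : forall i : 'I_p, measurable_fun Ysp (fun y => T y ord0 i))
  (* regular family *)
  (Theta_open : open (Theta nu Ysp h T))
  (T_aff_indep : forall (a : 'rV[R]_p) (b : R),
      {ae nu, forall y, Ysp y -> h y != 0 -> dotp a (T y) = b} -> a = 0)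
  (* covariates and model *)
  (Xsp : set (n.-tuple R)) (Wsp : set 'rV[R]_k)
  (lam : 'rV[R]_k -> n.-tuple R -> 'rV[R]_p)
  (lam_Theta : forall w x, Wsp w -> Xsp x -> Theta nu Ysp h T (lam w x))
  (lam_cont : {within [set z : 'rV[R]_k * 'rV[R]_n | Wsp z.1 /\ Xsp (tup_of_row z.2)],
                continuous (fun z : 'rV[R]_k * 'rV[R]_n => lam z.1 (tup_of_row z.2))})
  (* nominal distribution *)
  (xh : 'I_C -> n.-tuple R) (xh_inj : injective xh) (xhX : forall c, Xsp (xh c))
  (ph : 'I_C -> R) (ph0 : forall c, 0 <= ph c) (ph1 : \sum_(c < C) ph c = 1)
  (thh : 'I_C -> 'rV[R]_p) (thhT : forall c, Theta nu Ysp h T (thh c))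
  (PX : probability (n.-tuple R) R)
  (PXE : forall A, measurable A ->
           PX A = (\sum_(c < C) (ph c)%:E * \d_(xh c) A)%E)
  (PY : 'I_C -> probability (m.-tuple R) R)
  (PYd : forall c, has_density nu Ysp (fdens nu Ysp h T (thh c)) (PY c))
  (* radii *)
  (rho : 'I_C -> R) (eps : R) (rho0 : forall c, 0 <= rho c) (eps0 : 0 <= eps)
  (rho_eps : \sum_(c < C) ph c * rho c <= eps)
  (w : 'rV[R]_k) (wW : Wsp w)
  (* the gamma_c^* *)
  (gam : 'I_C -> R) (gam0 : forall c, 0 < gam c)
  (thsT : forall c, Theta nu Ysp h T (thh c - (gam c)^-1 *: lam w (xh c)))
  (gamE : forall c,
     Psi nu Ysp h T (thh c - (gam c)^-1 *: lam w (xh c))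
     + (gam c)^-1 * dotp (grad (Psi nu Ysp h T) (thh c - (gam c)^-1 *: lam w (xh c)))
                         (lam w (xh c))
     = Psi nu Ysp h T (thh c) - rho c)
  (* alpha^*, beta^* *)
  (alpha beta : R) (beta0 : 0 < beta)
  (eq1 : \sum_(c < C) ph c *
           expR (beta^-1 * (Psi nu Ysp h T (lam w (xh c))
                   - dotp (grad (Psi nu Ysp h T) (thh c - (gam c)^-1 *: lam w (xh c)))
                          (lam w (xh c)) - alpha) - rho c - 1) - 1 = 0)
  (eq2 : \sum_(c < C) ph c *
           (Psi nu Ysp h T (lam w (xh c))
              - dotp (grad (Psi nu Ysp h T) (thh c - (gam c)^-1 *: lam w (xh c)))
                     (lam w (xh c)) - alpha) *
           expR (beta^-1 * (Psi nu Ysp h T (lam w (xh c))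
                   - dotp (grad (Psi nu Ysp h T) (thh c - (gam c)^-1 *: lam w (xh c)))
                          (lam w (xh c)) - alpha) - rho c - 1)
         - (eps + 1) * beta = 0) :
  let B := ambiguity_set nu Ysp h T xh PX PY rho eps in
  let ths := fun c => thh c - (gam c)^-1 *: lam w (xh c) in
  let ts := fun c => Psi nu Ysp h T (lam w (xh c))
                     - dotp (grad (Psi nu Ysp h T) (ths c)) (lam w (xh c)) in
  let qs := fun c => ph c * expR (beta^-1 * (ts c - alpha) - rho c - 1) in
  let EL := fun Q : probability (n.-tuple R * m.-tuple R)%type R =>
              (\int[Q]_z (loss nu Ysp h T lam z.1 z.2 w)%:E)%E in
  exists (QYs : 'I_C -> probability (m.-tuple R) R)
         (Qs : probability (n.-tuple R * m.-tuple R)%type R),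
    [/\ (forall c, has_density nu Ysp (fdens nu Ysp h T (ths c)) (QYs c)),
        (forall E, measurable E ->
           Qs E = (\sum_(c < C) (qs c)%:E * QYs c [set y | E (xh c, y)])%E),
        B Qs &
        (forall Q, B Q -> (EL Q <= EL Qs)%E)].
Proof.
move=> B ths ts qs EL.
pose l c := lam w (xh c).
pose psi := Psi nu Ysp h T.
(* Weights summing to 1 force an index to exist; the nominal conditional at [c0] then makes the
   partition function positive. *)
have [c0 _] : exists c : 'I_C, True.
  apply: contrapT => nC; move: ph1; rewrite big1 => [/esym/eqP|c _].
    by rewrite oner_eq0.
  by case: nC; exists c.
have Z_gt0 th : (0 < Zint nu Ysp h T th)%E.
  exact: (Zint_gt0 mY mh h0 mT th (PYd c0)).
have [QYs QYsd] := choice (fun c =>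
  exp_family_probability mY mh h0 mT Z_gt0 (thsT c)).
have mxh c : measurable [set xh c] by exact: measurable_tuple_set1.
pose phi c := beta^-1 * (ts c - alpha) - rho c - 1.
have qs0 c : 0 <= qs c by rewrite mulr_ge0 ?expR_ge0.
have qs1 : \sum_(c < C) qs c = 1 by apply/eqP; rewrite -subr_eq0; apply/eqP.
have [QXs QXsE] := mixture_probability qs0
  (P := fun c => \d_(xh c)) (fun c => diracT R (xh c)) qs1.
have [Qs QsE] := slices_probability xh qs0 QYs qs1.
have mono (q t : 'I_C -> R) : (forall c, 0 <= q c) -> (forall c, t c <= ts c) ->
    \sum_(c < C) q c * t c <= \sum_(c < C) q c * ts c.
  by move=> q0 tts; apply: ler_sum => c _; rewrite ler_wpM2l.
(* Solving the definition of [phi c] for [ts c] gives $t_c=\alpha+\beta(\phi_c+\rho_c+1)$, which is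
   averaged against [q]. *)
have sphi q : \sum_(c < C) q c = 1 -> \sum_(c < C) q c * ts c =
    alpha + beta * (\sum_(c < C) q c * phi c + \sum_(c < C) rho c * q c + 1).
  move=> q1.
  transitivity (\sum_(c < C) (alpha * q c + beta * (q c * phi c + rho c * q c + q c))).
    by apply: eq_bigr => c _; rewrite /phi; field; rewrite gt_eqF.
  by rewrite big_split/= -!mulr_sumr !big_split/= q1 mulr1.
(* The tilted weights exhaust the budget [eps]: their mean of [ts] is computed once by [sphi] and
   once by the second equation for [alpha] and [beta]. *)
have qs_phi : \sum_(c < C) qs c * phi c + \sum_(c < C) rho c * qs c = eps.
  have := sphi _ qs1.
  have -> : \sum_(c < C) qs c * ts c = (eps + 1) * beta + alpha.
    have eq2' : \sum_(c < C) ph c * (ts c - alpha) * expR (phi c) = (eps + 1) * beta.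
      exact: subr0_eq eq2.
    rewrite -eq2' -[X in _ = _ + X]mulr1 -[in RHS]qs1 mulr_sumr -big_split/=.
    apply: eq_bigr => c _; rewrite /qs -/(phi c).
    by move: (ts c) (expR _) => t e; ring.
  move: (\sum_(c < C) _ * phi _) (\sum_(c < C) rho _ * _) => a b e.
  have {}e : beta * (a + b - eps) = 0 by lra.
  by move/eqP: e; rewrite mulf_eq0 gt_eqF//= subr_eq0 => /eqP.
(* The loss is affine in [T], so its expectation depends on the conditionals only through gradients
   of [Psi]. This serves [Qs] and every competitor alike. *)
have ELE (Q : probability (n.-tuple R * m.-tuple R)%type R) q th
    (QY : 'I_C -> probability (m.-tuple R) R) : (forall c, 0 <= q c) ->
    (forall c, Theta nu Ysp h T (th c)) ->
    (forall c, has_density nu Ysp (fdens nu Ysp h T (th c)) (QY c)) ->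
    (forall E, measurable E ->
      (Q E = \sum_(c < C) (q c)%:E * QY c [set y | E (xh c, y)])%E) ->
    EL Q = (\sum_(c < C) q c * (psi (l c) - dotp (grad psi (th c)) (l c)))%:E.
  move=> q0 thT QYd QE.
  pose g c y := dotp (- l c) (T y) + psi (l c).
  have gi c : (QY c).-integrable Ysp (EFin \o g c).
    rewrite (_ : EFin \o g c = (fun y => (dotp (- l c) (T y))%:E) \+ cst (psi (l c))%:E)%E//.
    apply: integrableD => //.
    - exact: (integrable_dotp mY mh h0 mT Theta_open (thT c) (QYd c)).
    - exact: finite_measure_integrable_cst.
  rewrite /EL (expectation_slices xh_inj mxh q0 (D := Ysp) (g := g) (PY := QY))//.
  - rewrite -sumEFin; apply: eq_bigr => c _; rewrite /g.
    rewrite (integral_affine mY mh h0 mT Z_gt0 Theta_open (thT c) (QYd c)).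
    by rewrite dotpNr [- _ + _]addrC.
  - by move=> c; exact: (density_setC mY (QYd c)).
  - by move=> c y _; rewrite /loss /g [dotp (- l c) _]dotpC dotpNr addrC.
have ELs : EL Qs = (\sum_(c < C) qs c * ts c)%:E.
  exact: (ELE Qs qs ths QYs qs0 thsT QYsd (fun E _ => QsE E)).
have KLY c Q th : Theta nu Ysp h T th -> has_density nu Ysp (fdens nu Ysp h T th) Q ->
    KL Q (PY c) = (dotp (grad psi th) (th - thh c) - psi th + psi (thh c))%:E.
  by move=> thT Qd; exact: (KL_exp_family mY mh h0 mT Z_gt0 Theta_open thT Qd (thhT c) (PYd c)).
have PXxh c : PX [set xh c] = (ph c)%:E by rewrite PXE// sum_dirac_set1.
have QXsxh c : QXs [set xh c] = (qs c)%:E by rewrite QXsE sum_dirac_set1.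
exists QYs, Qs; split => //.
- exists QXs, ths, QYs; split => //.
  + move=> c A mA; rewrite QsE QXsxh (bigD1 c)//= big1 => [|c' c'c].
      rewrite adde0; congr (_ * QYs c _)%E.
      by apply/seteqP; split => [y []|y].
    rewrite (_ : [set y | _] = set0) ?measure0 ?mule0//.
    apply/seteqP; split => // y /= [/xh_inj cc'].
    by rewrite cc' eqxx in c'c.
  + move=> c; rewrite (KLY c _ _ (thsT c) (QYsd c)) lee_fin -/(ths c).
    (* With this difference the divergence is expressed by the terms of [gamE], which makes it equal
       to [rho c]: the constraint is active. *)
    have -> : ths c - thh c = - ((gam c)^-1 *: l c) by rewrite /ths addrC addKr.
    rewrite dotpNr dotpC dotpZl dotpC.
    have := gamE c; rewrite -/(l c) -/psi -/(ths c).
    by move: (_ * dotp _ _) (psi (ths c)) (psi (thh c)) => a b e; lra.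
  + have qs_ac c : ph c = 0 -> qs c = 0 by rewrite /qs => ->; rewrite mul0r.
    rewrite (KL_discrete xh_inj mxh qs0 ph0 qs_ac (fun A _ => QXsE A) PXE).
    rewrite [X in (_ + X)%E](eq_bigr (fun c => (rho c * qs c)%:E)); last first.
      by move=> c _; rewrite EFinM; congr (_ * _)%E; exact: QXsxh.
    (* By [qs_phi] it remains to bound the divergence by the mean of [phi]; the logarithm of
       [qs c / ph c] is [phi c] whenever [ph c] is nonzero. *)
    rewrite sumEFin -EFinD lee_fin -qs_phi lerD2r.
    apply: ler_sum => c _; have [pc0|pc0] := eqVneq (ph c) 0.
      by rewrite /qs pc0 !mul0r.
    by rewrite /qs [X in ln (X / _)]mulrC mulfK// expRK.
- move=> Q [QX [th [QY [thT QYd QS KLQY KLQX]]]].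
  have S0 : (0 <= \sum_(c < C) (rho c)%:E * QX [set xh c])%E.
    by apply: sume_ge0 => c _; rewrite mule_ge0 ?lee_fin.
  (* Otherwise the divergence is infinite, and adding a nonnegative sum cannot bring it below
     [eps]. *)
  have dom : QX `<< PX.
    apply: contrapT => ndom; move: KLQX; rewrite /KL asboolF// addye ?leNgt ?ltry//.
    by apply: contraTneq S0 => ->.
  have domA A : measurable A -> PX A = 0%E -> QX A = 0%E.
    by move=> mA A0; move/null_content_dominatesP : dom; exact.
  pose q c := fine (QX [set xh c]).
  have qE c : QX [set xh c] = (q c)%:E by rewrite fineK// fin_num_measure.
  have q0 c : 0 <= q c by rewrite fine_ge0.
  have mrange := measurable_range mxh.
  (* The nominal marginal lives on the atoms, so by domination the competing one does too. *)
  have QXr : QX (~` range xh) = 0%E.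
    apply: domA; first exact: measurableC.
    rewrite PXE ?big1//; last exact: measurableC.
    move=> c _; rewrite diracE memNset ?mule0//=.
    by apply; exists c.
  have QXE A : measurable A -> (QX A = \sum_(c < C) (q c)%:E * \d_(xh c) A)%E.
    move=> mA; rewrite (measure_discrete xh_inj mxh QXr mA).
    by apply: eq_bigr => c _; rewrite qE.
  have q1 : \sum_(c < C) q c = 1.
    have := QXE _ measurableT; rewrite probability_setT.
    under eq_bigr do rewrite diracT mule1.
    by rewrite sumEFin => -[].
  have phq c : ph c = 0 -> q c = 0.
    by move=> pc; rewrite /q domA// PXxh pc.
  move: KLQX; rewrite (KL_discrete xh_inj mxh q0 ph0 phq QXE PXE).
  rewrite [X in (_ + X)%E](eq_bigr (fun c => (rho c * q c)%:E)); last first.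
    by move=> c _; rewrite EFinM; congr (_ * _)%E; exact: qE.
  rewrite sumEFin -EFinD lee_fin => KLq.
  have QE := measure_slices xh_inj mxh q1
    (fun c A mA => etrans (QS c A mA) (congr1 (fun e => e * QY c A)%E (qE c))).
  rewrite ELs (ELE Q q th QY q0 thT QYd QE) lee_fin.
  (* The conditionals are treated first, with the weights [q] fixed: each expected loss is at most
     [ts c]. *)
  apply: le_trans (mono q _ q0 _) _.
    move=> c; rewrite /ts -/(l c) -/psi lerD2l lerN2.
    have g0 : 0 < (gam c)^-1 by rewrite invr_gt0.
    apply: (dual_bound g0 (gamE c)
      (KL_exp_family_ge0 mY mh h0 mT Z_gt0 Theta_open (thT c) (QYd c) (thsT c))).
    by have := KLQY c; rewrite (KLY c _ _ (thT c) (QYd c)) lee_fin.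
  (* After cancelling [alpha] and [beta], the sum of the means of [phi] and [rho] under [q] must be
     at most [eps]. This is the budget constraint [KLq] once the divergence is bounded below by the
     mean of [phi]. *)
  rewrite !sphi// lerD2l ler_pM2l// lerD2r qs_phi.
  apply: le_trans KLq; rewrite lerD2r.
  apply: gibbs_inequality => //.
Qed.
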